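(* Let $\mathbb{N}^\dagger$ be the one-point compactification of the countable discrete space $\mathbb{N}$ of natural numbers. Then $\mathbb{N}^\dagger$ is $e$-closed but not $e$-open.
   Context: ''Space'' means compact metrizable space and ''map'' means continuous function. A space pair is a pair $(Y,Z)$ where $Y$ is a space and $Z\subseteq Y$ is a closed subspace. For spaces $X,Z$, $X^Z$ denotes the set of maps from $Z$ to $X$ with the topology of uniform convergence (equivalently, the compact-open topology). For a space pair $(Y,Z)$, $X^{Z\uparrow Y}\subseteq X^Z$ denotes the set of maps from $Z$ to $X$ which extend to a map from $Y$ to $X$. A space $X$ is $e$-open (respectively $e$-closed) if, for every space pair $(Y,Z)$, the set $X^{Z\uparrow Y}$ is open (respectively closed) in $X^Z$. *)

(* Defs.v *)
From HB Require Import structures.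
From mathcomp Require Import all_boot all_order all_algebra.
From mathcomp Require Import all_classical all_reals topology.
From mathcomp Require Import lra.

Set Implicit Arguments.
Unset Strict Implicit.
Unset Printing Implicit Defensive.

Import Order.TTheory GRing.Theory Num.Theory.

Local Open Scope classical_set_scope.
Local Open Scope ring_scope.

(* The library's [metricType] carries a chosen metric; here the metric is only
   required to exist and to induce the given neighbourhoods. *)
Definition metrizable (R : realType) (T : topologicalType) : Prop :=
  exists d : T -> T -> R,
    [/\ forall x y, 0 <= d x y,
        forall x y, d x y = 0 <-> x = y,
        forall x y, d x y = d y x,
        forall x y z, d x z <= d x y + d y z &
        forall x : T, nbhs x = nbhs_ball_ (fun x e => [set y | d x y < e]) x].

Record cm_space (R : realType) := CMSpace {
  cm_space_sort :> topologicalType;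
  cm_space_compact : compact [set: cm_space_sort];
  cm_space_metrizable : metrizable R cm_space_sort
}.

(* The continuous maps from [Z] to [X], with the topology induced by the
   compact-open topology on all functions. *)
Definition map_space (Z X : topologicalType) : topologicalType :=
  initial_topology (fun f : continuousType Z X => f : {compact-open, Z -> X}).

(* A subset [Z : set Y] used as a type is [set_type Z], whose library topology
   is the subspace topology; [set_val] is its inclusion in [Y]. *)
Definition extendable (X Y : topologicalType) (Z : set Y) :
    set (map_space Z X) :=
  [set f : continuousType Z X |
    exists g : continuousType Y X, forall z : Z, g (set_val z) = f z].

Definition e_open (R : realType) (X : cm_space R) : Prop :=
  forall (Y : cm_space R) (Z : set Y), closed Z -> open (@extendable X Y Z).

Definition e_closed (R : realType) (X : cm_space R) : Prop :=
  forall (Y : cm_space R) (Z : set Y), closed Z -> closed (@extendable X Y Z).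

(* In the library, [nat] is endowed with the discrete topology. *)
Definition Ndagger_top : topologicalType := one_point_compactification nat.

Lemma Ndagger_metrizable (R : realType) : metrizable R Ndagger_top.
Proof.
pose h (x : option nat) : R := if x is Some n then n.+1%:R^-1 else 0.
have h0 x : 0 <= h x by case: x => [n|] //=; rewrite invr_ge0.
have hS n : 0 < h (Some n) by rewrite /= invr_gt0.
have h_inj : injective h.
  move=> [n|] [m|] //= => [|/eqP|/esym/eqP]; last 2 first.
  - by rewrite invr_eq0 pnatr_eq0.
  - by rewrite invr_eq0 pnatr_eq0.
  by move=> /invr_inj/eqP; rewrite eqr_nat => /eqP [->].
pose d (x y : Ndagger_top) : R := if x == y then 0 else Num.max (h x) (h y).
have dE x y : x <> y -> d x y = Num.max (h x) (h y).
  by move=> /eqP/negPf xy; rewrite /d xy.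
have dxx x : d x x = 0 by rewrite /d eqxx.
exists d; split.
- by move=> x y; rewrite /d; case: ifP => // _; rewrite le_max h0.
- move=> x y; split=> [|->//]; apply: contraPP => xy; rewrite dE// => M0.
  apply: xy; apply: h_inj; apply: le_anti; move: (h0 x) (h0 y).
  have : h x <= 0 by rewrite -M0 le_max lexx.
  have : h y <= 0 by rewrite -M0 le_max lexx orbT.
  by move=> *; apply/andP; split; lra.
- by move=> x y; rewrite /d eq_sym maxC.
- move=> x y z; move: (h0 x) (h0 y) (h0 z) => hx hy hz.
  have [->|xz] := pselect (x = z).
    by rewrite dxx /d; case: ifP => _; case: ifP => _;
      rewrite ?addr0 ?addr_ge0// le_max ?hx ?hy ?hz ?orbT.
  have [->|xy] := pselect (x = y); first by rewrite dxx add0r.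
  have [->|yz] := pselect (y = z); first by rewrite dxx addr0.
  rewrite !dE// ge_max.
  have a : h x <= Num.max (h x) (h y) by rewrite le_max lexx.
  have b : h z <= Num.max (h y) (h z) by rewrite le_max lexx orbT.
  have a' : h y <= Num.max (h x) (h y) by rewrite le_max lexx orbT.
  have b' : h y <= Num.max (h y) (h z) by rewrite le_max lexx.
  by apply/andP; split; lra.
case=> [n|]; apply/seteqP; split=> U.
- move=> nU; exists (h (Some n)); [exact: hS | move=> y /=].
  have [<- _|ny] := pselect (Some n = y).
    exact: (@nbhs_singleton Ndagger_top (Some n) U nU).
  by rewrite dE// gt_max ltxx.
- case=> e /= e0 dU; change (nbhs n (Some @^-1` U)).
  by rewrite nbhs_principalE; apply/principal_filterP/dU; rewrite /= dxx.
- case=> W [cW _] WU.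
  have [N _ WN] : \forall N \near \oo, W `<=` (fun n => (n < N)%N).
    move/compact_near_coveringP : cW; apply => x _.
    exists ([set x], [set N | (x < N)%N]).
      split=> /=; last exact: nbhs_infty_gt.
      by rewrite nbhs_principalE; exact/principal_filterP.
    by case=> a b /= [-> ].
  exists (h (Some N)); [exact: hS | case=> [n|] /=]; last first.
    by move=> _; apply: WU; right.
  rewrite dE// gt_max => /andP[_ hnN]; apply: WU; left; exists n => // Wn.
  have := WN N (leqnn N) n Wn => /= nN; move: hnN.
  rewrite /h ltf_pV2 ?posrE// ltr_nat ltnS => Nn.
  by have := ltn_trans nN Nn; rewrite ltnn.
- case=> e /= e0 dU.
  exists [set n | e <= h (Some n)].
    split; last exact: discrete_closed.
    apply: finite_compact; apply: (@sub_finite_set _ _ `I_(Num.bound e^-1)) => //.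
    move=> n /= ehn; rewrite -(ltr_nat R).
    have : n.+1%:R <= e^-1 by rewrite -[leLHS]invrK lef_pV2 ?posrE ?invr_gt0 ?ltr0n.
    have := @archi_boundP R e^-1; rewrite invr_ge0 ltW// => /(_ isT).
    by rewrite -natr1; lra.
  move=> _ [[n /= /negP nn <-]|/= ->]; apply: dU => /=; last by rewrite dxx.
  by rewrite dE// gt_max e0 /= ltNge.
Qed.

Definition Ndagger (R : realType) : cm_space R :=
  CMSpace (@one_point_compactification_compact nat) (Ndagger_metrizable R).

(* Main.v *)
Require Import Defs.
From mathcomp Require Import all_boot all_reals.
From mathcomp Require Import order ssralg ssrnum interval all_classical topology.
From mathcomp Require Import num_normedtype normed_module.

Set Implicit Arguments.
Unset Strict Implicit.
Unset Printing Implicit Defensive.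

Import Order.TTheory GRing.Theory Num.Theory.
Import numFieldNormedType.Exports.

Local Open Scope classical_set_scope.

(** Write X for the one-point compactification of the natural numbers. All the
points n of X are clopen, and the only condition at the point at infinity is
that Some n tends to None. Hence a function g into X is continuous as soon as
its fibres over the points n are clopen ([continuous_Ndagger]): the fibre over
infinity is whatever remains.

Closedness. Let f : Z -> X be a limit of maps that extend to Y. A good enough
approximation of f has the same fibre over n as f, so the fibre over n of an
extension of it is a clopen subset C n of Y with trace f^-1(n) on Z. The C n
need not be disjoint, as they come from different approximations; sending y to
the least n with y in C n, and to infinity if there is none, repairs this
without changing the traces, which are disjoint already
([first_index_continuous]). By the criterion this function is continuous on Y,
and it extends f.

Non-openness. Take Y = [0, 1] and Z = {0, 1}. The constant map None on Z
extends to Y, and it is the limit of the maps sending 0 to None and 1 to Some n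
([near_Some_on_map]). None of the latter extends, since Y is connected and
Some n is a clopen point of X ([connected_Ndagger]). *)

(** * Compactness and connectedness of subspaces *)

Definition to_set_type (T : Type) (A : set T) (a : T) (Aa : A a) : set_type A :=
  exist _ a (mem_set Aa).

(** Stated for a set, compactness and connectedness pass to images under maps
that are continuous on that set only; a left inverse of the inclusion thus
transfers both of them to the subspace regarded as a type. *)
Lemma set_type_retract (T : topologicalType) (A : set T) : A !=set0 ->
  exists2 r : T -> set_type A, {within A, continuous r} &
    r @` A = [set: set_type A].
Proof.
move=> [a Aa].
pose r : T -> set_type A := insubd (to_set_type Aa).
have rK (x : set_type A) : r (\val x) = x by exact: valKd.
exists r.
  apply/subspace_sigL_continuousP.
  suff -> : sigL A r = id by move=> x; exact: cvg_id.
  by apply/funext => x; rewrite /sigL /= set_valE rK.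
by apply/seteqP; split=> // x _; exists (\val x); [exact: set_valP | exact: rK].
Qed.

Lemma compact_set_type (T : topologicalType) (A : set T) :
  compact A -> compact [set: set_type A].
Proof.
move=> cA; have [A0|/set0P/set_type_retract [r cr <-]] := eqVneq A set0.
  suff -> : [set: set_type A] = set0 by exact: compact0.
  rewrite -subset0 => a _.
  by have : set0 (\val a) by rewrite -A0; exact: set_valP.
exact: continuous_compact.
Qed.

Lemma connected_set_type (T : topologicalType) (A : set T) :
  A !=set0 -> connected A -> connected [set: set_type A].
Proof.
move=> /set_type_retract [r cr <-] cA.
exact: (connected_continuous_connected cA cr).
Qed.

(** * Maps into the one-point compactification *)

Lemma Ndagger_clopen_Some n : clopen ([set Some n] : set Ndagger_top).
Proof.
split.
  rewrite -image_set1; apply: one_point_compactification_open_some.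
  exact: discrete_open.
rewrite -[X in closed X]setCK closedC openE => -[m|] /= nm.
  change (nbhs m (Some @^-1` ~` [set Some n])).
  by rewrite nbhs_principalE; exact/principal_filterP.
exists [set n].
  split; [exact: compact_set1 | exact: discrete_closed].
by move=> _ [[m /= mn <-]|-> //] [].
Qed.

Lemma cvg_Some_None :
  (Some i : Ndagger_top) @[i --> \oo] --> (None : Ndagger_top).
Proof.
move=> U [W [cW _] WU].
have [N _ WN] : \forall N \near \oo, W `<=` (fun n => (n < N)%N).
  move/compact_near_coveringP : cW; apply => x _.
  exists ([set x], [set N | (x < N)%N]).
    split=> /=; last exact: nbhs_infty_gt.
    by rewrite nbhs_principalE; exact/principal_filterP.
  by case=> a b /= [-> ].
exists N => // n /= Nn; apply: WU; left; exists n => // Wn.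
by have := WN N (leqnn N) n Wn; rewrite /= ltnNge Nn.
Qed.

(** A neighbourhood of None misses only finitely many of the points Some i, so
its preimage contains a finite intersection of complements of clopen fibres. *)
Lemma continuous_Ndagger (T : topologicalType) (g : T -> Ndagger_top) :
  (forall n, clopen (g @^-1` [set Some n])) -> continuous g.
Proof.
move=> gn x U; case E : (g x) => [n|] nU.
  apply: (@filterS _ _ _ (g @^-1` [set Some n])).
    by move=> y /= ->; exact: (@nbhs_singleton Ndagger_top).
  by apply: open_nbhs_nbhs; split => //; case: (gn n).
have [N _ NU] := cvg_Some_None nU.
have UN : U None by exact: (@nbhs_singleton Ndagger_top).
have : \forall y \near x, forall i : 'I_N, (~` (g @^-1` [set Some (val i)])) y.
  apply: filter_forall => i; apply: open_nbhs_nbhs; split.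
    by apply: closed_openC; case: (gn i).
  by rewrite /= E.
apply: filterS => y yN /=; case Ey : (g y) => [n|//].
apply: NU => /=; rewrite leqNgt; apply/negP => nN.
exact: yN (Ordinal nN) _.
Qed.

(** The fibre over n is C n minus the finite union of the C i for i < n, which
is clopen: any sequence of clopen sets can be made disjoint. *)
Lemma first_index_continuous (T : topologicalType) (C : nat -> set T) :
  (forall n, clopen (C n)) ->
  exists2 g : T -> Ndagger_top, continuous g &
    forall x n, g x = Some n <-> C n x /\ forall i, (i < n)%N -> ~ C i x.
Proof.
move=> cC.
pose g x : Ndagger_top :=
  if pselect (exists n, `[<C n x>]) is left e then Some (ex_minn e) else None.
have gE x n : g x = Some n <-> C n x /\ forall i, (i < n)%N -> ~ C i x.
  rewrite /g; case: pselect => [e|e]; last first.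
    by split=> // -[Cn _]; case: e; exists n; exact/asboolP.
  case: ex_minnP => m /asboolP Cm mmin; split=> [[<-]|[Cn nmin]].
    by split=> // i im /asboolP /mmin; rewrite leqNgt im.
  congr Some; apply/eqP; rewrite eqn_leq mmin ?andTb; last exact/asboolP.
  by rewrite leqNgt; apply/negP => /nmin.
exists g => //; apply: continuous_Ndagger => n.
suff -> : g @^-1` [set Some n] = C n `&` \big[setI/setT]_(i < n) ~` C i.
  apply: clopenI => //; apply: big_ind => [||i _]; first exact: clopenT.
    exact: clopenI.
  exact: (@clopenC _ _ setT).
rewrite -(bigcap_mkord n (fun i => ~` C i)); apply/seteqP.
by split=> x /gE.
Qed.

(** * Closedness *)

Lemma map_space_open (Z X : topologicalType) (K : set Z) (O : set X) :
  compact K -> open O -> open ([set g | g @` K `<=` O] : set (map_space Z X)).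
Proof.
by move=> cK oO; exists [set g | g @` K `<=` O] => //; exact: compact_open_open.
Qed.

Lemma Ndagger_e_closed (R : realType) : e_closed (Ndagger R).
Proof.
move=> Y Z cZ f clf.
have cptZ : compact [set: set_type Z].
  apply: compact_set_type.
  exact: (subclosed_compact cZ (@cm_space_compact R Y)).
have [C CP] : {C : nat -> set Y & forall n, clopen (C n) /\
    forall z : set_type Z, C n (set_val z) <-> f z = Some n}.
  apply: (@choice _ _ (fun n (C : set Y) => clopen C /\
    forall z : set_type Z, C (set_val z) <-> f z = Some n)) => n.
  pose S : set Ndagger_top := [set Some n].
  have [oS cS] : clopen S by exact: Ndagger_clopen_Some.
  have cf := @cts_fun _ _ f.
  have [cK cK'] : clopen (f @^-1` S).
    by apply: preimage_clopen => //; exact: Ndagger_clopen_Some.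
  pose B : set (map_space (set_type Z) Ndagger_top) :=
    [set g | g @` (f @^-1` S) `<=` S] `&`
    [set g | g @` (~` (f @^-1` S)) `<=` ~` S].
  (* [B] consists of the maps with the same fibre over [n] as [f]. *)
  have nB : nbhs (f : map_space (set_type Z) Ndagger_top) B.
    apply: open_nbhs_nbhs; split.
      apply: openI; apply: map_space_open => //.
      - exact: subclosed_compact cptZ _.
      - by apply: subclosed_compact cptZ _ => //; exact: open_closedC.
      - exact: closed_openC.
    by split=> _ [z + <-].
  have [g [[h hg] [gS gS']]] := clf _ nB.
  exists (h @^-1` S); split.
    by apply: preimage_clopen; [exact: Ndagger_clopen_Some | exact: cts_fun].
  move=> z; rewrite /S /= hg; split=> [gz|fz]; last by apply: gS; exists z.
  by apply: contrapT => fz; apply: (gS' (g z)) => //; exists z.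
have [F cF FE] := first_index_continuous (fun n => (CP n).1).
exists (mkcts cF) => z /=.
case E : (f z) => [n|].
  apply/FE; split=> [|i ni /(CP i).2]; first exact/(CP n).2.
  by rewrite E => -[ein]; rewrite ein ltnn in ni.
case E' : (F (set_val z)) => [n|//].
by have [/(CP n).2] := proj1 (FE _ _) E'; rewrite E.
Qed.

(** * Non-openness *)

Lemma metrizable_sub (R : realType) (A : set R) :
  metrizable R (set_type A).
Proof.
exists (fun x y => `|\val x - \val y|)%R; split.
- by move=> x y; exact: normr_ge0.
- move=> x y; split=> [/eqP|->]; last by rewrite subrr normr0.
  by rewrite normr_eq0 subr_eq0 => /eqP/val_inj.
- by move=> x y; exact: distrC.
- by move=> x y z; exact: ler_distD.
- by move=> x; rewrite -nbhs_ballE.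
Qed.

Definition unit_interval (R : realType) : cm_space R :=
  CMSpace (compact_set_type (@segment_compact R 0%R 1%R))
          (metrizable_sub `[0%R : R, 1%R]%classic).

Definition Some_on (T : Type) (C : set T) (n : nat) (x : T) : Ndagger_top :=
  if `[<C x>] then Some n else None.

Lemma continuous_Some_on (T : topologicalType) (C : set T) n :
  clopen C -> continuous (Some_on C n).
Proof.
move=> cC; apply: continuous_Ndagger => m.
have [<-|nm] := eqVneq n m.
  suff -> : Some_on C n @^-1` [set Some n] = C by [].
  by apply/seteqP; split=> x /=; rewrite /Some_on; case: asboolP.
suff -> : Some_on C n @^-1` [set Some m] = set0 by exact: clopen0.
rewrite -subset0 => x /=; rewrite /Some_on; case: asboolP => // _ [/eqP].
by rewrite (negPf nm).
Qed.

Definition Some_on_map (T : topologicalType) (C : set T) (n : nat)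
    (cC : clopen C) : continuousType T Ndagger_top :=
  mkcts (@continuous_Some_on T C n cC).

Definition None_map (T : topologicalType) : continuousType T Ndagger_top :=
  mkcts (@cst_continuous T Ndagger_top None).

Lemma connected_Ndagger (T : topologicalType) (g : T -> Ndagger_top)
    (a b : T) n :
  connected [set: T] -> continuous g -> g a = Some n -> g b = Some n.
Proof.
move=> cT cg ga; have [oS cS] := preimage_clopen (Ndagger_clopen_Some n) cg.
have gT : g @^-1` [set Some n] = setT.
  apply: cT; first by exists a.
    by exists (g @^-1` [set Some n]); rewrite ?setTI.
  by exists (g @^-1` [set Some n]); rewrite ?setTI.
by have : [set: T] b by []; rewrite -gT.
Qed.

(** The maps [Some_on C n] tend to None uniformly, as Some n tends to None and
the other value is None itself. *)
Lemma near_Some_on_map (Z : topologicalType) (C : set Z) (cC : clopen C)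
    (E : set (map_space Z Ndagger_top)) :
  open E -> E (None_map Z) -> \forall n \near \oo, E (Some_on_map n cC).
Proof.
move=> [W oW <-] WN.
suff : (Some_on C n : {compact-open, Z -> Ndagger_top}) @[n --> \oo] -->
    (cst None : {compact-open, Z -> Ndagger_top}).
  by apply; apply: open_nbhs_nbhs.
apply/compact_open_cvgP => K O _ oO sO.
have [[z Kz]|K0] := pselect (K !=set0); last first.
  by exists 0 => // n _ y [x Kx _]; case: K0; exists x.
have ON : O None by apply: sO; exists z.
have [N _ NO] := cvg_Some_None (open_nbhs_nbhs (conj oO ON)).
by exists N => // n /NO On y [x _ <-]; rewrite /Some_on; case: asboolP.
Qed.

Lemma closed_comp_eq (R : realType) (T : topologicalType) (h : T -> R) (a : R) :
  continuous h -> closed [set x | h x = a].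
Proof. move=> ch; exact: (continuous_closedP _).1 ch _ (@closed_eq R a). Qed.

Lemma Ndagger_not_e_open (R : realType) : ~ e_open (Ndagger R).
Proof.
move=> eo; pose Y := unit_interval R.
pose v : Y -> R := \val.
have cv : continuous v by exact: initial_continuous.
have in0 : `[0%R : R, 1%R]%classic 0%R by rewrite /= in_itv /= lexx ler01.
have in1 : `[0%R : R, 1%R]%classic 1%R by rewrite /= in_itv /= lexx ler01.
pose y0 : Y := to_set_type in0; pose y1 : Y := to_set_type in1.
pose Z : set Y := [set y | v y = 0%R] `|` [set y | v y = 1%R].
have cZ : closed Z by apply: closedU; exact: closed_comp_eq.
have Zy0 : Z y0 by left.
have Zy1 : Z y1 by right.
pose z0 : set_type Z := to_set_type Zy0.
pose z1 : set_type Z := to_set_type Zy1.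
pose w (z : set_type Z) : R := v (set_val z).
have cw : continuous w.
  by move=> z; apply: continuous_comp; [exact: initial_continuous | exact: cv].
have cC : clopen [set z | w z = 1%R].
  split; last exact: closed_comp_eq.
  suff -> : [set z | w z = 1%R] = ~` [set z | w z = 0%R].
    exact/closed_openC/closed_comp_eq.
  apply/seteqP; split=> z /=; first by move=> -> /eqP; rewrite oner_eq0.
  by case: (set_valP z).
have /(near_Some_on_map cC (eo Y Z cZ)) : extendable (None_map (set_type Z)).
  by exists (None_map Y).
move=> [n _ /(_ n (leqnn n)) [g gE]].
have cY : connected [set: Y].
  by apply: connected_set_type; [exists 0%R | exact: segment_connected].
have gEC z : g (set_val z) = Some_on [set z | w z = 1%R] n z := gE z.
have g1 : g y1 = Some n.
  by have := gEC z1; rewrite /Some_on asboolT.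
have g0 : g y0 = None.
  have := gEC z0; rewrite /Some_on asboolF //.
  by move=> /esym/eqP; rewrite oner_eq0.
by have := connected_Ndagger y0 cY (@cts_fun _ _ g) g1; rewrite g0.
Qed.

Theorem proposition2p4 (R : realType) :
  e_closed (Ndagger R) /\ ~ e_open (Ndagger R).
Proof. by split; [exact: Ndagger_e_closed | exact: Ndagger_not_e_open]. Qed.
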